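(* Let $G$ be a unicyclic graph with diameter $d(G)$ and girth $r$. Then $$m_G[0,1)\geq \left\lceil \frac{d(G)}{3} \right\rceil + \left\lceil \frac{r}{6} \right\rceil-1.$$
   Context: All graphs are finite and simple. A unicyclic graph is a connected graph containing exactly one cycle; its girth $r\ge 3$ is the length of that cycle. The diameter $d(G)$ of a connected graph is the largest distance between two of its vertices. The Laplacian matrix of $G$ is $L(G)=D(G)-A(G)$, where $D(G)$ is the diagonal matrix of vertex degrees and $A(G)$ is the adjacency matrix; its eigenvalues are the Laplacian eigenvalues of $G$. $m_G[0,1)$ denotes the number of Laplacian eigenvalues of $G$, counted with multiplicity, lying in the interval $[0,1)$. *)

(* Defs.v *)
From mathcomp Require Import all_boot all_order all_algebra.

Set Implicit Arguments.
Unset Strict Implicit.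
Unset Printing Implicit Defensive.

Import Order.TTheory GRing.Theory Num.Theory.

Local Open Scope ring_scope.

(* A finite simple graph is a finite type T of vertices with a symmetric and  *)
(* irreflexive adjacency relation e : rel T.                                  *)

Section Graph.

Variables (T : finType) (e : rel T).

Definition connected_graph : Prop := forall x y : T, connect e x y.

Definition walk (x y : T) (n : nat) : bool :=
  [exists p : n.-tuple T, path e x p && (last x p == y)].

(* If y is reachable from x, a shortest walk has length less than #|T|, so    *)
(* this is the usual distance; otherwise the value is #|T|.                   *)
Definition gdist (x y : T) : nat := find (walk x y) (iota 0 #|T|).

Definition diameter : nat := (\max_(x : T) \max_(y : T) gdist x y)%N.

Definition graph_cycle (c : seq T) : bool := ucycleb e c && (3 <= size c)%N.

(* Two vertex sequences describe the same cycle of the graph (up to rotation  *)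
(* and reversal) exactly when they have the same edges.                       *)
Definition cycle_edges (c : seq T) : {set {set T}} :=
  [set [set x; next c x] | x in c].

Definition only_cycle (c : seq T) : Prop :=
  graph_cycle c /\
  forall c' : seq T, graph_cycle c' -> cycle_edges c' = cycle_edges c.

Definition unicyclic : Prop := connected_graph /\ exists c, only_cycle c.

Definition unicyclic_girth (r : nat) : Prop :=
  exists2 c, only_cycle c & size c = r.

Definition degree (x : T) : nat := #|[set y | e x y]|.

(* Vertices are numbered by enum_val : 'I_#|T| -> T.                          *)
Definition degree_mx (R : pzRingType) : 'M[R]_#|T| :=
  diag_mx (\row_i (degree (enum_val i))%:R).

Definition adjacency_mx (R : pzRingType) : 'M[R]_#|T| :=
  \matrix_(i, j) (e (enum_val i) (enum_val j))%:R.

Definition laplacian (R : pzRingType) : 'M[R]_#|T| :=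
  degree_mx R - adjacency_mx R.

End Graph.

(* The roots of the characteristic polynomial, with multiplicity.             *)
Definition eigenvalues (C : closedFieldType) (n : nat) (A : 'M[C]_n) : seq C :=
  sval (closed_field_poly_normal (char_poly A)).

(* In a numClosedFieldType, 0 <= x < 1 implies that x is real. The Laplacian  *)
(* being Hermitian, all of its eigenvalues are real.                          *)
Definition m01 (C : numClosedFieldType) (T : finType) (e : rel T) : nat :=
  count (fun x : C => 0 <= x < 1) (eigenvalues (laplacian e C)).

(* Main.v *)
Require Import Defs.
From HB Require Import structures.
From mathcomp Require Import all_boot all_order all_algebra.
From mathcomp Require Import ring zify.

Set Implicit Arguments.
Unset Strict Implicit.
Unset Printing Implicit Defensive.

Import Order.TTheory GRing.Theory Num.Theory.

(* The number of Laplacian eigenvalues in [0,1) is the largest dimension of a *)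
(* space of functions x with                                                  *)
(*   sum_(edges uv) |x_u - x_v|^2 < sum_v |x_v|^2   unless x = 0.             *)
(* Let P be a diametral path and K the cycle. Everything outside the core     *)
(* P + K (and a link between them if they are disjoint) consists of trees,    *)
(* each hanging off the core at one vertex; extending x constantly along      *)
(* these trees costs no edge term, so it is enough to work on the core.       *)
(*   Consecutive path vertices u, u, t, t - u contribute exactly -|t|^2 to    *)
(* the form, whatever u is, so a hanging path yields one dimension per three  *)
(* vertices. Three vertices inside an arc of the cycle likewise yield one     *)
(* dimension and shorten the arc by three edges, up to a change of sign of x  *)
(* beyond them; hence six of them give two dimensions and leave the rest of   *)
(* the cycle unaffected.                                                      *)
(*   If P meets K in at most one vertex, or if P leaves K at both ends by a   *)
(* multiple of 3 vertices, the cycle is cut open at one vertex and shortened  *)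
(* modulo 6. Otherwise P splits K into arcs of s <= m edges and leaves it by  *)
(* tails of a and b vertices. A tail of length not divisible by 3 gives one   *)
(* more dimension, with a form at least as negative as any cross terms at its *)
(* foot, and one counts dimensions according to a, b and s modulo 3.          *)

(** The bound is a min-max estimate: by [test_space_m01] it suffices to produce enough formal
    parameters on which the form of L - 1 is at most minus their sum of squares. Combinatorially, an
    edge outside a core containing the cycle cannot close a second cycle, so labels of the core
    extend at no cost ([core_retraction], [core_extension]). By [configuration] the core is of one
    of two kinds: a path with a cycle attached at, or linked to, one of its vertices
    ([path_and_cycle]), or a cycle with tails of a and b vertices whose feet cut it into arcs of s
    <= m edges, with d = a + s + b and r = s + m ([two_tail_cycle]). Analytically, [blocks_form] and
    [arc_form] evaluate the form exactly on groups of three vertices, one parameter per group.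

    The target is ceil(d/3) + floor((r-1)/6) dimensions. The first kind gives floor(d/3) + 1 + 2
    floor((r-1)/6). For the second, the residues of a, b and s modulo 3 select one of four counts,
    compared with the target in [two_tail_cycle_bound]; there s <= m, a consequence of the path
    being geodesic, is essential. *)

Local Open Scope ring_scope.

(** * Spectrum of a normal matrix *)

Section Spectrum.

Local Open Scope sesquilinear_scope.

Variable C : numClosedFieldType.

Lemma char_poly_uconj n (P A : 'M[C]_n) :
  P \in unitmx -> char_poly (invmx P *m A *m P) = char_poly A.
Proof.
move=> uP; set Pp := map_mx polyC P.
have uPp : map_mx polyC (invmx P) *m Pp = 1%:M.
  by rewrite -map_mxM mulVmx // map_mx1.
rewrite /char_poly.
have -> : char_poly_mx (invmx P *m A *m P) =
          map_mx polyC (invmx P) *m char_poly_mx A *m Pp.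
  by rewrite /char_poly_mx mulmxBr mulmxBl !map_mxM mul_mx_scalar -scalemxAl
             uPp scalemx1.
by rewrite !det_mulmx mulrAC -det_mulmx uPp det1 mul1r.
Qed.

Lemma perm_eigenvalues_normal n (A : 'M[C]_n) : A \is normalmx ->
  perm_eq (eigenvalues A) [seq spectral_diag A 0 i | i <- enum 'I_n].
Proof.
move=> /orthomx_spectralP; set P := spectralmx A; set d := spectral_diag A.
move=> defA; rewrite /eigenvalues.
case: closed_field_poly_normal => s /=.
rewrite (monicP (char_poly_monic A)) scale1r => defs.
apply: prod_XsubC_eq; rewrite -defs defA char_poly_uconj ?spectral_unit //.
rewrite char_poly_trig ?diag_mx_is_trig // big_map big_enum /=.
by apply: eq_bigr => i _; rewrite mxE eqxx.
Qed.

Lemma spectral_form n (A : 'M[C]_n) (z : 'rV_n) : A \is normalmx ->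
  ((z *m spectralmx A) *m A *m (z *m spectralmx A)^t*) 0 0 =
  \sum_i spectral_diag A 0 i * `|z 0 i| ^+ 2.
Proof.
move=> /orthomx_spectralP; have uP := spectral_unitarymx A.
set P := spectralmx A in uP *; set d := spectral_diag A => defA.
rewrite trmx_mul map_mxM [in LHS]defA !mulmxA mulmxK ?spectral_unit //.
rewrite mulmxtVK // mul_mx_diag mxE.
by apply: eq_bigr => i _; rewrite !mxE normCK; ring.
Qed.

Lemma unitary_sqnorm n (P : 'M[C]_n) (z : 'rV_n) : P \is unitarymx ->
  ((z *m P) *m (z *m P)^t*) 0 0 = \sum_i `|z 0 i| ^+ 2.
Proof.
move=> uP; rewrite trmx_mul map_mxM mulmxA mulmxtVK // mxE.
by apply: eq_bigr => i _; rewrite !mxE normCK.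
Qed.

(* Courant-Fischer: on a subspace of dimension exceeding the number of        *)
(* eigenvalues below 1 some vector has only coordinates of eigenvalue >= 1.   *)
Lemma leq_count_eigenvalues n k (A : 'M[C]_n) (X : 'M[C]_(k, n)) :
    A \is normalmx -> (forall y : 'rV_n, 0 <= (y *m A *m y^t*) 0 0) ->
    (forall c : 'rV_k, c != 0 ->
       ((c *m X) *m A *m (c *m X)^t*) 0 0 < ((c *m X) *m (c *m X)^t*) 0 0) ->
  (k <= count (fun x => 0 <= x < 1)%R (eigenvalues A))%N.
Proof.
move=> nA A_ge0 X_lt; have uP := spectral_unitarymx A.
rewrite (permP (perm_eigenvalues_normal nA)) count_map.
set P := spectralmx A in uP *; set d := spectral_diag A.
have d_ge0 i : 0 <= d 0 i.
  have := A_ge0 (delta_mx 0 i *m P); rewrite spectral_form // (bigD1 i) //=.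
  rewrite big1 ?addr0 => [|j /negPf ji]; rewrite mxE ?eqxx ?ji ?normr0.
    by rewrite normr1 expr1n mulr1.
  by rewrite expr0n mulr0.
rewrite leqNgt; apply/negP => lt_k.
pose S := [pred i : 'I_n | 0 <= d 0 i < 1].
have cardS : #|S| = count (preim (fun i => d 0 i) (fun x => 0 <= x < 1)) (enum
  'I_n).
  by rewrite cardE /(enum S) size_filter enumT.
rewrite -{}cardS in lt_k.
pose M : 'M[C]_(k, #|S|) := \matrix_(a, b) (X *m P^t*) a (enum_val b).
have /rowV0Pn[c /sub_kermxP cM c0] : kermx M != 0.
  by rewrite kermx_eq0 -row_leq_rank -ltnNge (leq_ltn_trans (rank_leq_col _)).
have := X_lt c c0; set y := c *m X.
have -> : y = y *m P^t* *m P by rewrite mulmxKtV.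
set z := y *m P^t*; rewrite spectral_form // unitary_sqnorm //.
apply/negP; rewrite -real_leNgt; first last.
- by apply: rpred_sum => i _; rewrite ger0_real ?mulr_ge0 ?exprn_ge0.
- by apply: rpred_sum => i _; rewrite ger0_real ?exprn_ge0.
apply: ler_sum => i _; have [iS|] := boolP (i \in S).
  suff -> : z 0 i = 0 by rewrite normr0 expr0n mulr0.
  have := congr1 (fun N : 'rV_#|S| => N 0 (enum_rank_in iS i)) cM.
  rewrite [RHS]mxE mxE => <-; rewrite /z /y -mulmxA mxE; apply: eq_bigr => j _.
  by rewrite [M _ _]mxE enum_rankK_in.
rewrite inE d_ge0 /= -real_leNgt ?ger0_real // => d1.
by rewrite -[leLHS]mul1r ler_wpM2r ?exprn_ge0.
Qed.

End Spectrum.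

(** * Test spaces for the Laplacian *)

Definition sumsq (C : numClosedFieldType) (V : zmodType) (f : {additive V -> C})
  (ts : seq V) : C :=
  \sum_(t <- ts) `|f t| ^+ 2.

Section TestSpaces.

Variables (C : numClosedFieldType) (T : finType) (e : rel T).

(* Twice the Laplacian form: each edge occurs in both orientations.           *)
Definition dirichlet (f : T -> C) : C :=
  \sum_u \sum_v (e u v)%:R * `|f u - f v| ^+ 2.

Lemma degreeE (R : pzRingType) u : (degree e u)%:R = \sum_v (e u v)%:R :> R.
Proof.
rewrite /degree cardsE -sum1_card natr_sum big_mkcond /=.
by apply: eq_bigr => v _; rewrite unfold_in; case: ifP.
Qed.

Lemma laplacianE (R : pzRingType) i j : laplacian e R i j =
  (i == j)%:R * (degree e (enum_val j))%:R - (e (enum_val i) (enum_val j))%:R.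
Proof.
by rewrite !mxE; case: eqVneq => [->|]; rewrite ?mulr1n ?mulr0n ?mul1r ?mul0r.
Qed.

Lemma laplacian_form (f : T -> C) : symmetric e ->
  let y : 'rV_#|T| := \row_i f (enum_val i) in
  ((y *m laplacian e C *m (map_mx Num.conj y^T)) 0 0) *+ 2 = dirichlet f.
Proof.
move=> e_sym y; pose w u v : C := (e u v)%:R * (f u * (f v)^*).
have -> : (y *m laplacian e C *m (map_mx Num.conj y^T)) 0 0 =
    \sum_u (\sum_v (e u v)%:R * `|f u| ^+ 2 - \sum_v w v u).
  rewrite mxE [RHS](reindex (enum_val : 'I_#|T| -> T)) /=;
    last exact/onW_bij/enum_val_bij.
  apply: eq_bigr => j _; rewrite mxE mulr_suml.
  under [LHS]eq_bigr do rewrite laplacianE !mxE mulrBr mulrBl.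
  rewrite sumrB; congr (_ - _).
    rewrite (bigD1 j) //= big1 => [|i /negPf ij];
      last by rewrite ij mul0r mulr0 mul0r.
    rewrite eqxx mul1r addr0 -mulr_suml degreeE normCK; ring.
  rewrite [RHS](reindex (enum_val : 'I_#|T| -> T)) /=;
    last exact/onW_bij/enum_val_bij.
  by apply: eq_bigr => i _; rewrite /w; ring.
rewrite /dirichlet sumrB.
have dsym : \sum_u \sum_v (e u v)%:R * `|f u| ^+ 2 =
            \sum_u \sum_v (e u v)%:R * `|f v| ^+ 2 :> C.
  rewrite exchange_big; apply: eq_bigr => u _.
  by apply: eq_bigr => v _; rewrite e_sym.
have wsym : \sum_u \sum_v w v u = \sum_u \sum_v w u v by rewrite exchange_big.
rewrite mulr2n {1}dsym {1}wsym addrACA -opprD -!big_split -sumrB /=.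
apply: eq_bigr => u _; rewrite -!big_split -sumrB /=; apply: eq_bigr => v _.
by rewrite /w (e_sym v u) !normCK rmorphB /=; ring.
Qed.

Lemma dirichlet_ge0 (f : T -> C) : 0 <= dirichlet f.
Proof.
by apply: sumr_ge0 => u _; apply: sumr_ge0 => v _; rewrite mulr_ge0 ?exprn_ge0.
Qed.

(* A k-dimensional test space, given by the values of its vectors as linear   *)
(* forms in k formal parameters bs, on which the form of L - 1 is at most     *)
(* minus the standard one.                                                    *)
Definition test_space (k : nat) : Prop :=
  forall (V : zmodType) (bs : seq V), size bs = k ->
  exists x : T -> V, forall f : {additive V -> C},
    dirichlet (f \o x) <=
    (\sum_v `|f (x v)| ^+ 2 - sumsq f bs) *+ 2.

End TestSpaces.

(** Evaluation of formal parameters at the coefficient vector [c]. Labels are integer combinations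
    of parameters, so additivity is all that a test space asks of an evaluation. *)
Definition row_eval (C : numClosedFieldType) k (c : 'rV[C]_k) (v : 'cV[C]_k) :
  C :=
  (c *m v) 0 0.

Fact row_eval_additive (C : numClosedFieldType) k (c : 'rV[C]_k) :
  zmod_morphism (row_eval c).
Proof. by move=> u v; rewrite /row_eval mulmxBr [LHS]mxE [X in _ + X]mxE. Qed.

HB.instance Definition _ (C : numClosedFieldType) k (c : 'rV[C]_k) :=
  GRing.isZmodMorphism.Build _ _ (row_eval c) (row_eval_additive c).

Section LaplacianSpectrum.

Variables (C : numClosedFieldType) (T : finType) (e : rel T).
Hypothesis e_sym : symmetric e.

Lemma laplacian_normal : laplacian e C \is normalmx.
Proof.
apply: symmetric_normalmx.
  apply/is_hermitianmxP; rewrite expr0 scale1r map_mx_id //.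
  apply/matrixP => i j; rewrite [RHS]mxE !laplacianE e_sym eq_sym.
  by case: eqVneq => [->|]; rewrite ?mul0r.
by apply/mxOverP => i j; rewrite laplacianE rpredB ?rpredM ?realn.
Qed.

(** The parameters are taken to be the standard basis; evaluated at [c] their sum of squares is the
    squared norm of [c], positive for nonzero [c]. This gives the strict inequality of
    [leq_count_eigenvalues]. *)
Lemma test_space_m01 k : test_space C e k -> (k <= m01 C e)%N.
Proof.
pose bs : seq 'cV[C]_k := [seq delta_mx i 0 | i <- enum 'I_k].
move=> /(_ _ bs) [|x x_neg]; first by rewrite size_map size_enum_ord.
pose X : 'M[C]_(k, #|T|) := \matrix_(a, j) x (enum_val j) a 0.
have form (y : 'rV_#|T|) : ((y *m laplacian e C *m (map_mx Num.conj y^T)) 0 0)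
  *+ 2 =
    dirichlet e (fun v => y 0 (enum_rank v)).
  rewrite -laplacian_form //=.
  suff <- : y = \row_i y 0 (enum_rank (enum_val i)) by [].
  by apply/rowP => i; rewrite mxE enum_valK.
apply: (@leq_count_eigenvalues C _ _ _ X laplacian_normal) => [y|c c0].
  by rewrite -(pmulrn_lge0 _ (isT : (0 < 2)%N)) form dirichlet_ge0.
rewrite -(ltr_pMn2r (isT : (0 < 2)%N)) form.
have Xc v : (c *m X) 0 (enum_rank v) = row_eval c (x v).
  by rewrite /row_eval !mxE; apply: eq_bigr => a _; rewrite mxE enum_rankK.
have -> : dirichlet e (fun v => (c *m X) 0 (enum_rank v)) =
          dirichlet e (row_eval c \o x).
  by apply: eq_bigr => u _; apply: eq_bigr => v _; rewrite !Xc.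
apply: le_lt_trans (x_neg (row_eval c)) _; rewrite ltr_pMn2r //.
have -> : ((c *m X) *m map_mx Num.conj (c *m X)^T) 0 0 =
          \sum_v `|row_eval c (x v)| ^+ 2.
  rewrite mxE (reindex (enum_rank : T -> 'I_#|T|)) /=;
    last exact/onW_bij/enum_rank_bij.
  by apply: eq_bigr => v _; rewrite [map_mx _ _ _ _]mxE [_^T _ _]mxE Xc normCK.
rewrite ltrBlDr ltrDl /sumsq big_map big_enum /= lt0r.
rewrite sumr_ge0 ?andbT => [|i _]; last exact: exprn_ge0.
apply: contra c0 => /eqP c0; apply/eqP/rowP => i; rewrite [RHS]mxE.
have /psumr_eq0P sum0 : \sum_i `|row_eval c (delta_mx i 0)| ^+ 2 = 0 := c0.
have /eqP := sum0 (fun i _ => exprn_ge0 2 (normr_ge0 _)) i isT.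
by rewrite expf_eq0 normr_eq0 /row_eval /= -colE mxE => /eqP.
Qed.

End LaplacianSpectrum.

(** * The form along a path *)

Section LineForms.

Variable C : numClosedFieldType.

(* The form of L - 1 along a path u :: xs, without the mass of u.             *)
Fixpoint line_form (u : C) (xs : seq C) : C :=
  if xs is x :: xs' then `|u - x| ^+ 2 - `|x| ^+ 2 + line_form x xs' else 0.

Lemma line_form_cat u xs ys :
  line_form u (xs ++ ys) = line_form u xs + line_form (last u xs) ys.
Proof. by elim: xs u => [|x xs IH] u /=; rewrite ?add0r // IH addrA. Qed.

Lemma line_form_nseq (u : C) n : line_form u (nseq n u) = - (`|u| ^+ 2 *+ n).
Proof.
elim: n => [|n IH] /=; first by rewrite oppr0.
by rewrite IH subrr normr0 expr0n sub0r mulrS opprD.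
Qed.

Variable V : zmodType.
Implicit Types (f : {additive V -> C}) (al be y t : V) (ts : seq V).

Lemma sumsq_cat f ts ts' : sumsq f (ts ++ ts') = sumsq f ts + sumsq f ts'.
Proof. by rewrite /sumsq big_cat. Qed.

Lemma sumsq_cons f t ts : sumsq f (t :: ts) = `|f t| ^+ 2 + sumsq f ts.
Proof. by rewrite /sumsq big_cons. Qed.

Fixpoint blocks y ts : seq V :=
  if ts is t :: ts' then y :: t :: (t - y) :: blocks (t - y) ts' else [::].

Lemma size_blocks y ts : size (blocks y ts) = (3 * size ts)%N.
Proof. by elim: ts y => //= t ts IH y; rewrite IH; lia. Qed.

Lemma blocks_form f y ts : line_form (f y) (map f (blocks y ts)) = - sumsq f ts.
Proof.
elim: ts y => [|t ts IH] y; first by rewrite /sumsq big_nil oppr0.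
by rewrite sumsq_cons /= IH !raddfB !normCK /=; ring.
Qed.

(* Three vertices between al and y replace an edge from -al to y, at the      *)
(* price of one free parameter t of negative square: solving the eigenvalue   *)
(* equation for 1 on a path gives values x with x_(j+3) = - x_j.              *)
Fixpoint arc al be ts : seq V :=
  if ts is t :: ts' then
    let rest := arc (- al) be ts' in
    let y := head be rest in
    t - y :: t - al - y :: t - al :: rest
  else [::].

Lemma size_arc al be ts : size (arc al be ts) = (3 * size ts)%N.
Proof. by elim: ts al => //= t ts IH al; rewrite IH; lia. Qed.

Lemma arc_form f al be ts :
  line_form (f al) (map f (rcons (arc al be ts) be)) =
  `|f al - (-1) ^+ size ts * f be| ^+ 2 - `|f be| ^+ 2 - sumsq f ts.
Proof.
elim: ts al => [|t ts IH] al /=.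
  by rewrite /sumsq big_nil mul1r subr0 addr0.
have {IH} := IH (- al); set rest := arc _ _ _.
(* The vertex after the three new ones heads [rest], or is [be] itself when no group is left. *)
have -> : rcons rest be = head be rest :: behead (rcons rest be) by case: rest.
rewrite /= sumsq_cons !raddfN; move: (head be rest) => y.
set l := line_form _ _ => IH.
have -> : l = `|- f al - (-1) ^+ size ts * f be| ^+ 2 - `|f be| ^+ 2
   - sumsq f ts - (`|- f al - f y| ^+ 2 - `|f y| ^+ 2).
  by rewrite -IH; ring.
by rewrite [(-1) ^+ (size ts).+1]exprS !raddfB !normCK /=; ring.
Qed.

Lemma normrB_sq (x y : C) :
  `|x - y| ^+ 2 <= `|x| ^+ 2 *+ 2 + `|y| ^+ 2 *+ 2.
Proof.
rewrite -subr_ge0; have -> : `|x| ^+ 2 *+ 2 + `|y| ^+ 2 *+ 2 - `|x - y| ^+ 2 =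
  `|x + y| ^+ 2 by rewrite !normCK; ring.
exact: exprn_ge0.
Qed.

(** An arc with arbitrary end values. If 3 does not divide [n], a spare vertex carries 0 and
    decouples the ends; otherwise the remaining edge from [al] to plus or minus [be] is bounded
    crudely. *)
Lemma arc_dirichlet al be n ts : size ts = (n %/ 3)%N ->
  exists2 xs : seq V, size xs = n & forall f,
    line_form (f al) (map f (rcons xs be)) <=
    `|f al| ^+ 2 *+ 2 + `|f be| ^+ 2 - sumsq f ts.
Proof.
move=> size_ts; have := divn_eq n 3; have := ltn_mod n 3.
case: (n %% 3)%N => [_|j _] def_n.
  exists (arc al be ts) => [|f]; first by rewrite size_arc; lia.
  rewrite arc_form lerD2r lerBlDr -addrA -mulr2n.
  apply: le_trans (normrB_sq _ _) _.
  by rewrite normrM normrX normrN1 expr1n mul1r.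
exists (rcons (arc al 0 ts) 0 ++ nseq j 0) => [|f].
  by rewrite size_cat size_rcons size_arc size_nseq; lia.
rewrite -cats1 !map_cat !line_form_cat arc_form map_nseq last_cat last_map.
rewrite last_rcons raddf0 line_form_nseq.
have -> : last 0 (nseq j 0) = 0 :> C by elim: (j).
rewrite /= mulr0 subr0 normr0 expr0n sub0r normrN mul0rn oppr0 -subr_ge0.
rewrite [X in 0 <= X](_ : _ = `|f al| ^+ 2 + `|f be| ^+ 2); last by ring.
by rewrite addr_ge0 ?exprn_ge0.
Qed.

(** An even number of groups restores the sign, so the shortened arc joins [al] to [al] at no edge
    cost; the [n %% 6] leftover vertices repeat [al]. *)
Lemma arc_constant al n ts : size ts = (2 * (n %/ 6))%N ->
  exists2 xs : seq V, size xs = n & forall f,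
    line_form (f al) (map f (rcons xs al)) <= - `|f al| ^+ 2 - sumsq f ts.
Proof.
move=> size_ts; exists (arc al al ts ++ nseq (n %% 6) al) => [|f].
  by rewrite size_cat size_nseq size_arc; have := divn_eq n 6; lia.
have -> : rcons (arc al al ts ++ nseq (n %% 6) al) al =
          rcons (arc al al ts) al ++ nseq (n %% 6) al.
  by rewrite rcons_cat cat_rcons; congr (_ ++ _); elim: (n %% 6)%N => //= j ->.
rewrite map_cat line_form_cat arc_form last_map last_rcons map_nseq.
rewrite line_form_nseq size_ts exprM sqrrN !expr1n mul1r subrr normr0 expr0n.
by rewrite sub0r gerDl oppr_le0 mulrn_wge0 ?exprn_ge0.
Qed.

(** The foot value is chosen here. For residue 1 the foot is t and the next vertex 6t, contributing
    25 - 36 = -11; for residue 2 the foot is 0, followed by t, t. The multiple 9 outweighs the 3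
    that arcs cost at a foot. *)
Lemma tail_strong n t ts : (n %% 3 != 0)%N -> size ts = (n %/ 3)%N ->
  exists al, exists2 xs : seq V, size xs = n & forall f,
    line_form (f al) (map f xs) <=
    - (`|f al| ^+ 2 *+ 9) - `|f t| ^+ 2 - sumsq f ts.
Proof.
move=> n3 size_ts; have := divn_eq n 3; have := ltn_mod n 3.
case: (n %% 3)%N n3 => // [] [|[|//]] _ _ def_n.
  exists t, (t *+ 6 :: blocks (t *+ 6) ts) => [|f].
    by rewrite /= size_blocks; lia.
  rewrite /= blocks_form raddfMn lerD2r -subr_ge0 !normCK.
  rewrite [X in 0 <= X](_ : _ = `|f t| ^+ 2); last by rewrite normCK; ring.
  exact: exprn_ge0.
exists 0, [:: t, t & blocks t ts] => [|f]; first by rewrite /= size_blocks; lia.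
by rewrite /= blocks_form raddf0 !normCK -subr_ge0 le_eqVlt; apply/orP; left;
  apply/eqP; ring.
Qed.

(** Unlike in [tail_strong], the foot value stays free, at the price of its square. *)
Lemma tail_two al n t ts : (n %% 3 = 2)%N -> size ts = (n %/ 3)%N ->
  exists2 xs : seq V, size xs = n & forall f,
    line_form (f al) (map f xs) = `|f al| ^+ 2 - `|f t| ^+ 2 - sumsq f ts.
Proof.
move=> n3 size_ts; exists [:: t, t - al & blocks (t - al) ts] => [|f].
  by rewrite /= size_blocks; have := divn_eq n 3; lia.
by rewrite /= blocks_form raddfB !normCK; ring.
Qed.

(** The two spare vertices both carry y = 3 al up to sign, which gives 4 - 9 = -5 at the first; the
    second, joined to the end value 0, contributes -9 + 9 = 0. *)
Lemma arc_strong al n ts : (n %% 3 = 2)%N -> size ts = (n %/ 3)%N ->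
  exists2 xs : seq V, size xs = n & forall f,
    line_form (f al) (map f (rcons xs 0)) = - (`|f al| ^+ 2 *+ 5) - sumsq f ts.
Proof.
move=> n3 size_ts; pose y := (if odd (size ts) then - al else al) *+ 3.
exists (rcons (arc al y ts) y ++ [:: y]) => [|f].
  by rewrite size_cat size_rcons size_arc /=; have := divn_eq n 3; lia.
rewrite -cats1 -catA map_cat line_form_cat arc_form last_map last_rcons /=.
have -> : (-1) ^+ size ts * f y = f al *+ 3.
  rewrite /y raddfMn -signr_odd; case: (odd _); rewrite ?raddfN /=; ring.
have -> : `|f y| ^+ 2 = `|f al *+ 3| ^+ 2.
  by rewrite /y raddfMn; case: (odd _); rewrite ?raddfN ?mulNrn ?normrN.
have e2 : f y * (f y)^* = (f al *+ 3) * (f al *+ 3)^*.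
  by rewrite /y raddfMn -!normCK; case: (odd _);
    rewrite ?raddfN ?mulNrn ?normrN.
rewrite raddf0 !normCK subr0 e2; ring.
Qed.

End LineForms.

(** * Dimension counts on the possible cores *)

Lemma cat_of_sizeD (V : Type) (bs : seq V) m n : size bs = (m + n)%N ->
  exists ts us, [/\ bs = ts ++ us, size ts = m & size us = n].
Proof.
move=> size_bs; exists (take m bs), (drop m bs).
rewrite cat_take_drop size_drop size_takel ?size_bs ?leq_addr //.
by rewrite addKn.
Qed.

Lemma cons_of_sizeS (V : Type) (bs : seq V) n : size bs = n.+1 ->
  exists t ts, bs = t :: ts /\ size ts = n.
Proof. by case: bs => // t ts [<-]; exists t, ts. Qed.

Section Models.

Variables (C : numClosedFieldType) (T : finType) (e : rel T).

(* A cycle through two vertices, with values al and be, that cut it into arcs *)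
(* of s and m edges, and with tails of a and b vertices at these two.         *)
Definition two_tail_cycle (a b s m : nat) : Prop :=
  forall (V : zmodType) (al be : V) (A B S Q : seq V),
    size A = a -> size B = b -> (size S).+1 = s -> (size Q).+1 = m ->
  exists x : T -> V, forall f : {additive V -> C},
    dirichlet e (f \o x) <= (\sum_v `|f (x v)| ^+ 2 +
      (line_form (f al) (map f A) + line_form (f be) (map f B) +
       line_form (f al) (map f (rcons S be)) +
       line_form (f be) (map f (rcons Q al)))) *+ 2.

(* A path with d edges and a cycle of length r one vertex of which carries    *)
(* the value of the j-th vertex of the path.                                  *)
Definition path_and_cycle (d j r : nat) : Prop :=
  forall (V : zmodType) (xi : V) (P Q : seq V),
    size P = d -> (size Q).+1 = r -> let al := nth 0 (xi :: P) j in
  exists x : T -> V, forall f : {additive V -> C},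
    dirichlet e (f \o x) <= (\sum_v `|f (x v)| ^+ 2 +
      (- `|f xi| ^+ 2 + line_form (f xi) (map f P) + `|f al| ^+ 2 +
       line_form (f al) (map f (rcons Q al)))) *+ 2.

Lemma two_tail_cycleC a b s m :
  two_tail_cycle a b s m -> two_tail_cycle b a m s.
Proof.
move=> mod_ab V al be A B S Q sA sB sS sQ.
have [x xP] := mod_ab V be al B A Q S sB sA sQ sS; exists x => f.
by apply: le_trans (xP f) _; rewrite lerMn2r /= lerD2l le_eqVlt; apply/orP;
  left; apply/eqP; ring.
Qed.

(** The first [d %% 3 + 1] path vertices all carry [xi], whose own mass makes it a parameter; blocks
    fill the rest. On the cycle, [arc_constant] cancels the correction for the doubly counted
    [al]. *)
Lemma path_and_cycle_test_space d j r : (0 < r)%N ->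
  path_and_cycle d j r -> test_space C e ((d %/ 3).+1 + 2 * (r.-1 %/ 6)).
Proof.
move=> r_gt0 mod_d V bs /cat_of_sizeD[us [vs [-> sus svs]]].
have [xi [ts [-> sts]]] := cons_of_sizeS sus.
pose P := nseq (d %% 3) xi ++ blocks xi ts.
have sP : size P = d by rewrite size_cat size_nseq size_blocks sts; lia.
have [Q sQ QP] := arc_constant C (nth 0 (xi :: P) j) svs.
have {mod_d} [|x xP] := mod_d V xi P Q sP; first by rewrite sQ; lia.
exists x => f; apply: le_trans (xP f) _; rewrite lerMn2r /= lerD2l.
have {QP} := QP f; set L := line_form _ _; set al := nth _ _ _ => leL.
rewrite map_cat map_nseq line_form_cat line_form_nseq.
have -> : last (f xi) (nseq (d %% 3) (f xi)) = f xi by elim: (d %% 3)%N.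
rewrite blocks_form sumsq_cons sumsq_cat.
rewrite -subr_ge0 in leL; rewrite -subr_ge0.
rewrite [X in 0 <= X](_ : _ = `|f xi| ^+ 2 *+ (d %% 3) +
  (- `|f al| ^+ 2 - sumsq f vs - L)); last by ring.
by rewrite addr_ge0 ?mulrn_wge0 ?exprn_ge0.
Qed.

Lemma rcons_of_sizeS (V : Type) (bs : seq V) n : size bs = n.+1 ->
  exists ts t, bs = rcons ts t /\ size ts = n.
Proof.
by case/lastP: bs => // ts t; rewrite size_rcons => -[<-]; exists ts, t.
Qed.

(* A cycle cut open at al splits at its second marked vertex; tails of length *)
(* divisible by 3 decouple from the value of the vertex that carries them.    *)
Lemma two_tail_cycle_open a b s m :
    (0 < s)%N -> (0 < m)%N -> (3 %| b)%N -> two_tail_cycle a b s m ->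
  forall (V : zmodType) (al : V) (A R us : seq V),
    size A = a -> (size R).+1 = (s + m)%N -> size us = (b %/ 3)%N ->
  exists x : T -> V, forall f : {additive V -> C},
    dirichlet e (f \o x) <= (\sum_v `|f (x v)| ^+ 2 +
      (line_form (f al) (map f A) + line_form (f al) (map f (rcons R al)) -
       sumsq f us)) *+ 2.
Proof.
move=> s_gt0 m_gt0 b3 mod_ab V al A R us sA sR sus.
have [|R1 [Q [-> sR1 sQ]]] := @cat_of_sizeD _ R s m.-1; first by lia.
have [S [be [-> sS]]] := rcons_of_sizeS (etrans sR1 (esym (prednK s_gt0))).
have sB : size (blocks be us) = b by rewrite size_blocks sus; lia.
have [||x xP] := mod_ab V al be A (blocks be us) S Q sA sB; try by lia.
exists x => f; apply: le_trans (xP f) _; rewrite lerMn2r /= lerD2l.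
rewrite blocks_form rcons_cat map_cat line_form_cat last_map last_rcons.
by rewrite le_eqVlt; apply/orP; left; apply/eqP; ring.
Qed.

(** Besides the blocks of both tails, [al] is a parameter: its square comes from [arc_constant] on
    the opened cycle. *)
Lemma two_tail_cycle_dvd_dvd a b s m :
  (0 < s)%N -> (0 < m)%N -> (3 %| a)%N -> (3 %| b)%N ->
  two_tail_cycle a b s m ->
  test_space C e (b %/ 3 + (a %/ 3 + (2 * ((s + m).-1 %/ 6)).+1)).
Proof.
move=> s_gt0 m_gt0 a3 b3 mod_ab V bs.
move=> /cat_of_sizeD[us [bs' [-> sus /cat_of_sizeD[vs [ws' [-> svs]]]]]].
move=> /cons_of_sizeS[al [ws [-> sws]]].
have [R sR RP] := arc_constant C al sws.
have sA : size (blocks al vs) = a by rewrite size_blocks svs; lia.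
have [|x xP] := two_tail_cycle_open s_gt0 m_gt0 b3 mod_ab al sA _ sus (R := R).
  by rewrite sR; lia.
exists x => f; apply: le_trans (xP f) _; rewrite lerMn2r /= lerD2l.
rewrite blocks_form !(sumsq_cat, sumsq_cons).
have := RP f; rewrite -subr_ge0 => RP'; rewrite -subr_ge0.
by apply: le_trans RP' _; rewrite le_eqVlt; apply/orP; left; apply/eqP; ring.
Qed.

(** The tail at [al] supplies -9 times its square, and the opened cycle, an arc from [al] to itself,
    costs at most 3. *)
Lemma two_tail_cycle_ndvd_dvd a b s m :
  (0 < s)%N -> (0 < m)%N -> (a %% 3 != 0)%N -> (3 %| b)%N ->
  two_tail_cycle a b s m ->
  test_space C e (b %/ 3 + ((a %/ 3).+1 + (s + m).-1 %/ 3)).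
Proof.
move=> s_gt0 m_gt0 a3 b3 mod_ab V bs.
move=> /cat_of_sizeD[us [bs' [-> sus /cat_of_sizeD[vs' [ws [-> + sws]]]]]].
move=> /cons_of_sizeS[t [vs [-> svs]]].
have [al [A sA AP]] := tail_strong C t a3 svs.
have [R sR RP] := arc_dirichlet C al al sws.
have [|x xP] := two_tail_cycle_open s_gt0 m_gt0 b3 mod_ab al sA _ sus (R := R).
  by rewrite sR; lia.
exists x => f; apply: le_trans (xP f) _; rewrite lerMn2r /= lerD2l.
rewrite !(sumsq_cat, sumsq_cons).
have := lerD (AP f) (RP f); rewrite -(lerD2r (- sumsq f us)).
move=> /le_trans -> //; rewrite -subr_ge0.
rewrite [X in 0 <= X](_ : _ = `|f al| ^+ 2 *+ 6); last by ring.
by rewrite mulrn_wge0 ?exprn_ge0.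
Qed.

Lemma two_tail_cycle_ndvd_ndvd a b s m :
  (0 < s)%N -> (0 < m)%N -> (a %% 3 != 0)%N -> (b %% 3 != 0)%N ->
  two_tail_cycle a b s m ->
  test_space C e ((a %/ 3).+1 + ((b %/ 3).+1 + (s.-1 %/ 3 + m.-1 %/ 3))).
Proof.
move=> s_gt0 m_gt0 a3 b3 mod_ab V bs.
move=> /cat_of_sizeD[us' [bs' [-> + /cat_of_sizeD[vs' [bs2 [->]]]]]].
move=> /cons_of_sizeS[t [us [-> sus]]] /cons_of_sizeS[t' [vs [-> svs]]].
move=> /cat_of_sizeD[ws [ws' [-> sws sws']]].
have [al [A sA AP]] := tail_strong C t a3 sus.
have [be [B sB BP]] := tail_strong C t' b3 svs.
have [S sS SP] := arc_dirichlet C al be sws.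
have [Q sQ QP] := arc_dirichlet C be al sws'.
have [||x xP] := mod_ab V al be A B S Q sA sB; try by lia.
exists x => f; apply: le_trans (xP f) _; rewrite lerMn2r /= lerD2l.
rewrite !(sumsq_cat, sumsq_cons).
apply: le_trans (lerD (lerD (lerD (AP f) (BP f)) (SP f)) (QP f)) _.
rewrite -subr_ge0.
rewrite [X in 0 <= X](_ : _ = `|f al| ^+ 2 *+ 6 + `|f be| ^+ 2 *+ 6);
  last by ring.
by rewrite addr_ge0 ?mulrn_wge0 ?exprn_ge0.
Qed.

(** With 0 at the second foot, [al] becomes an extra parameter: tail, strong arc and other arc give
    at most 1 - 5 + 1 = -3 times its square. The arc of [s] edges has [s.-1] inner vertices,
    congruent to 2 modulo 3. *)
Lemma two_tail_cycle_two_two a b s m :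
  (0 < s)%N -> (0 < m)%N -> (a %% 3 = 2)%N -> (b %% 3 = 2)%N -> (3 %| s)%N ->
  two_tail_cycle a b s m ->
  test_space C e ((a %/ 3).+1 + ((b %/ 3).+1 + ((s.-1 %/ 3).+1 + m.-1 %/ 3))).
Proof.
move=> s_gt0 m_gt0 a3 b3 s3 mod_ab V bs.
move=> /cat_of_sizeD[us' [bs' [-> + /cat_of_sizeD[vs' [bs2 [->]]]]]].
move=> /cons_of_sizeS[t [us [-> sus]]] /cons_of_sizeS[t' [vs [-> svs]]].
move=> /cat_of_sizeD[ws2 [ws' [-> + sws']]] => /cons_of_sizeS[al [ws [-> sws]]].
have [A sA AP] := tail_two C al t a3 sus.
have [B sB BP] := tail_two C 0 t' b3 svs.
have [|S sS SP] := arc_strong C al _ sws; first by lia.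
have [Q sQ QP] := arc_dirichlet C 0 al sws'.
have [||x xP] := mod_ab V al 0 A B S Q sA sB; try by lia.
exists x => f; apply: le_trans (xP f) _; rewrite lerMn2r /= lerD2l.
rewrite !(sumsq_cat, sumsq_cons).
rewrite AP BP SP -lerBrDl; apply: le_trans (QP f) _.
rewrite !raddf0 !normr0 expr0n /= -subr_ge0.
rewrite [X in 0 <= X](_ : _ = `|f al| ^+ 2 *+ 2); last by ring.
by rewrite mulrn_wge0 ?exprn_ge0.
Qed.

End Models.

(** * Constant extension from a core of a unicyclic graph *)

Section Steps.

Variable T : eqType.
Implicit Types (u v x : T) (xs p : seq T) (z : T * T).

Definition steps u xs : seq (T * T) := zip (u :: xs) xs.

Lemma steps_cons u x xs : steps u (x :: xs) = (u, x) :: steps x xs.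
Proof. by []. Qed.

Lemma steps_cat u xs ys :
  steps u (xs ++ ys) = steps u xs ++ steps (last u xs) ys.
Proof. by elim: xs u => // x xs IH u; rewrite cat_cons !steps_cons IH. Qed.

Lemma mem_steps u xs z : z \in steps u xs -> (z.1 \in belast u xs) && (z.2 \in
  xs).
Proof.
elim: xs u => // x xs IH u; rewrite steps_cons in_cons => /predU1P[->|/IH].
  by rewrite !inE /= !eqxx.
by rewrite !in_cons => /andP[-> ->]; rewrite !orbT.
Qed.

Lemma steps_path (e : rel T) u xs z : path e u xs -> z \in steps u xs -> e z.1
  z.2.
Proof.
elim: xs u => // x xs IH u /= /andP[ux px].
by rewrite in_cons => /predU1P[->|/IH->].
Qed.

Lemma steps_next x p u :
  u \in x :: p -> (u, next (x :: p) u) \in steps x (rcons p x).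
Proof.
have gen y0 y q : u \in y :: q -> (u, next_at u y0 y q) \in steps y (rcons q
  y0).
  elim: q y => [|y' q IH] y; rewrite in_cons;
    first by rewrite orbF => /eqP-> /=; rewrite eqxx mem_head.
  rewrite rcons_cons steps_cons /=; have [->|] := eqVneq u y.
    by rewrite mem_head.
  by move=> _ /IH u_in; rewrite in_cons u_in orbT.
exact: gen.
Qed.

End Steps.

Lemma connect_steps (T : finType) (k : rel T) (u : T) xs :
  (forall z, z \in steps u xs -> k z.1 z.2) -> {in u :: xs, forall v, connect k
    u v}.
Proof.
move=> k_steps v v_in; have pk : path k u xs.
  elim: xs u k_steps {v_in} => //= x xs IH u k_steps.
  rewrite (k_steps (u, x)) ?mem_head //=; apply: IH => z z_in.
  by apply: k_steps; rewrite in_cons z_in orbT.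
by apply: (path_connect pk).
Qed.

Lemma labelling (T : eqType) (V : zmodType) (hs : seq T) (vs : seq V) :
  uniq hs -> size hs = size vs -> exists g : T -> V, map g hs = vs.
Proof.
move=> hs_uniq eq_size; exists (fun h => nth 0 vs (index h hs)).
apply: (@eq_from_nth _ 0) => [|i]; rewrite size_map // => i_lt.
case: hs hs_uniq eq_size i_lt => // h hs hs_uniq _ i_lt.
by rewrite (nth_map h) // index_uniq.
Qed.

Lemma set2_neq (T : finType) (x y u v : T) :
  x != u -> y != u -> [set x; y] != [set u; v].
Proof.
move=> xu yu; apply: contraNneq xu => /setP/(_ u).
by rewrite !inE eqxx eq_sym [u == y]eq_sym (negPf yu) orbF.
Qed.

Lemma set2_rel (T : finType) (r : rel T) (x y u v : T) :
  symmetric r -> [set x; y] = [set u; v] -> r x y = r u v.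
Proof.
move=> r_sym eq_xy; have := set21 u v; have := set22 u v.
have := set21 x y; have := set22 x y; rewrite {1 2}eq_xy -{3 4}eq_xy !inE.
by do 4!case/orP=> /eqP ?; subst; rewrite // r_sym.
Qed.

Section LineSteps.

Variables (C : numClosedFieldType) (T : eqType).

Lemma line_form_steps (g : T -> C) u xs : line_form (g u) (map g xs) =
  \sum_(z <- steps u xs) `|g z.1 - g z.2| ^+ 2 - \sum_(x <- xs) `|g x| ^+ 2.
Proof.
elim: xs u => [|x xs IH] u; first by rewrite !big_nil subr0.
by rewrite steps_cons !big_cons /= IH; ring.
Qed.

End LineSteps.

Section Extension.

Variables (T : finType) (e : rel T) (c : seq T).
Hypotheses (e_sym : symmetric e) (e_irr : irreflexive e).
Hypotheses (e_conn : connected_graph e) (c_only : only_cycle e c).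

Lemma cycle_edges_only c' : graph_cycle e c' -> cycle_edges c' = cycle_edges c.
Proof. exact: c_only.2. Qed.

(** A simple detour around the edge closes up with it to a cycle, which has the edges of [c]. *)
Lemma edge_on_cycle u v : e u v ->
    connect [rel x y | e x y && ([set x; y] != [set u; v])] u v ->
  [set u; v] \in cycle_edges c.
Proof.
move=> uv /connectP[p0 path0 def_v].
case/shortenP: path0 def_v => p path_p uniq_p _ def_v.
have pe : path e u p by apply: sub_path path_p => x y /andP[].
rewrite -(@cycle_edges_only (u :: p)).
  apply/imsetP; exists v; rewrite ?[v in v \in _]def_v ?mem_last //.
  by rewrite next_nth def_v mem_last index_last // nth_default // setUC.
apply/andP; split.
  by rewrite /ucycleb uniq_p /= rcons_path pe -def_v e_sym uv.
(* A detour of fewer than two steps would be a loop or the removed edge itself. *)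
case: p path_p def_v {uniq_p pe} => [|y [|z p]] //=; first by move=> _ v_u;
  rewrite v_u e_irr in uv.
by move=> + v_y; rewrite v_y eqxx andbF.
Qed.

Section Retraction.

Variable k : rel T.
Hypotheses (k_sym : symmetric k) (k_sub : subrel k e).
Hypothesis k_cycle : forall u v, e u v -> [set u; v] \in cycle_edges c -> k u v.
Variables (H : {set T}) (root : T).
Hypotheses (root_H : root \in H) (k_H : forall u v, k u v -> u \in H).
Hypothesis k_conn : {in H, forall h, connect k root h}.

Let off : rel T := [rel u v | e u v && ~~ k u v].

Let off_sym : connect_sym off.
Proof. by apply: sym_connect_sym => u v; rewrite /off /= e_sym k_sym. Qed.

Let k_conn2 u v : u \in H -> v \in H -> connect k u v.
Proof.
by move=> /k_conn + /k_conn; rewrite (sym_connect_sym k_sym);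
  apply: connect_trans.
Qed.

(** The first edge of a simple path off the core could be bypassed through the core and back along
    the rest of the path, so it would lie on the cycle, hence in the core. *)
Lemma off_core_unique u v : u \in H -> v \in H -> connect off u v -> u = v.
Proof.
move=> uH vH /connectP[p0 path0 def_v].
case/shortenP: path0 def_v => -[|y p] //= /andP[/andP[uy uyNk] path_p].
case/andP=> u_notin _ _ def_v; case/negP: (uyNk); apply: k_cycle => //.
apply: edge_on_cycle => //.
apply: (@connect_trans _ _ v).
  apply: connect_sub (k_conn2 uH vH) => x z xz; apply: connect1.
  rewrite /= k_sub //=; apply: contraNneq uyNk => eq_xz.
  by rewrite -(set2_rel k_sym eq_xz).
rewrite sym_connect_sym => [|x z]; last by rewrite /= e_sym setUC.
rewrite def_v; apply/connectP; exists p => //.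
apply: (@sub_in_path _ (mem (y :: p))) path_p; last exact/allP.
move=> x z x_in z_in /andP[/= -> _]; apply: set2_neq.
  by apply: contraNneq u_notin => <-.
by apply: contraNneq u_notin => <-.
Qed.

Lemma off_core_exists v : exists2 h, h \in H & connect off v h.
Proof.
have /connectP[p] := e_conn v root.
elim: p v => [|u p IH] v /= => [_ <-|/andP[vu /IH + last_p]].
  by exists root; rewrite ?connect0.
case/(_ last_p) => h hH uh; have [vuk|vuNk] := boolP (k v u).
  by exists v; rewrite ?connect0 // (k_H vuk).
by exists h => //; apply: connect_trans uh; rewrite connect1 // /off /= vu.
Qed.

(* The components of the graph without core edges are trees hanging off the   *)
(* core at one vertex each, so labels extend from the core constantly.        *)
Lemma core_retraction (V : Type) (g : T -> V) : exists x : T -> V,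
  {in H, x =1 g} /\ forall u v, e u v -> ~~ k u v -> x u = x v.
Proof.
pose pi v := s2val (sig2_eqW (off_core_exists v)).
have piH v : pi v \in H by rewrite /pi; case: sig2_eqW.
have pi_off v : connect off v (pi v) by rewrite /pi; case: sig2_eqW.
exists (g \o pi); split => [h hH /=|u v uv uvNk /=].
  by rewrite -(off_core_unique hH (piH h) (pi_off h)).
congr g; apply: off_core_unique => //.
apply: connect_trans (pi_off v); apply: (@connect_trans _ _ u).
  by rewrite off_sym.
by rewrite connect1 // /off /= uv.
Qed.

End Retraction.

End Extension.

Section Bounds.

Variables (C : numClosedFieldType) (T : finType).

Lemma ler_sum_seq (I : finType) (P : pred I) (w : I -> C) (s : seq I) :
  (forall i, 0 <= w i) -> (forall i, P i -> w i != 0 -> i \in s) ->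
  \sum_(i | P i) w i <= \sum_(i <- s) w i.
Proof.
move=> w_ge0; elim: s P => [|j s IH] P sP.
  by rewrite big_nil big1 // => i /sP; rewrite in_nil;
    case: eqP => // _ /(_ isT).
rewrite big_cons.
have le_tl : \sum_(i | P i && (i != j)) w i <= \sum_(i <- s) w i.
  by apply: IH => i /andP[/sP si ij] /si; rewrite in_cons (negPf ij).
have [Pj|PNj] := boolP (P j); first by rewrite (bigD1 j) //= lerD2l.
apply: le_trans (ler_wpDl (w_ge0 j) le_tl); rewrite le_eqVlt; apply/orP; left.
apply/eqP/eq_bigl => i; have [->|_] := eqVneq i j; last by rewrite andbT.
by rewrite (negPf PNj).
Qed.

Lemma dirichlet_le (e : rel T) (ks : seq (T * T)) (f : T -> C) :
  (forall u v, e u v -> f u != f v -> ((u, v) \in ks) || ((v, u) \in ks)) ->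
  dirichlet e f <= (\sum_(z <- ks) `|f z.1 - f z.2| ^+ 2) *+ 2.
Proof.
move=> ksP; pose w (z : T * T) : C := `|f z.1 - f z.2| ^+ 2.
have -> : dirichlet e f = \sum_(z | e z.1 z.2) w z.
  rewrite /dirichlet pair_big [RHS]big_mkcond /=; apply: eq_bigr => z _.
  by case: ifP => _; rewrite ?mul1r ?mul0r.
pose swap (z : T * T) := (z.2, z.1).
have -> : (\sum_(z <- ks) w z) *+ 2 = \sum_(z <- ks ++ map swap ks) w z.
  by rewrite big_cat big_map mulr2n; congr (_ + _); apply: eq_bigr => z _;
    rewrite /w distrC.
apply: ler_sum_seq => [z|[u v] /= uv]; first exact: exprn_ge0.
rewrite expf_eq0 normr_eq0 subr_eq0 /= => /(ksP u v uv) /orP[ks_in|ks_in].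
  by rewrite mem_cat ks_in.
by rewrite mem_cat orbC; apply/orP; left; apply/mapP; exists (v, u).
Qed.

Variables (e : rel T) (c : seq T).
Hypotheses (e_sym : symmetric e) (e_irr : irreflexive e).
Hypotheses (e_conn : connected_graph e) (c_only : only_cycle e c).


Definition core_rel (ks : seq (T * T)) : rel T :=
  [rel u v | ((u, v) \in ks) || ((v, u) \in ks)].

(** [ks] lists the core edges and [hs] distinct core vertices whose mass is kept; discarding the
    mass of all other vertices only weakens the estimate. *)
Lemma core_extension (ks : seq (T * T)) (hs : seq T) (root : T) :
    (forall z, z \in ks -> e z.1 z.2 && connect (core_rel ks) root z.1) ->
    (forall u v, e u v -> [set u; v] \in cycle_edges c -> core_rel ks u v) ->
    uniq hs -> {in hs, forall h, connect (core_rel ks) root h} ->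
  forall (V : zmodType) (g : T -> V), exists x : T -> V,
  forall f : {additive V -> C}, dirichlet e (f \o x) <=
    (\sum_v `|f (x v)| ^+ 2 + (\sum_(z <- ks) `|f (g z.1) - f (g z.2)| ^+ 2 -
     \sum_(h <- hs) `|f (g h)| ^+ 2)) *+ 2.
Proof.
move=> ksP cycle_ks hs_uniq hs_conn V g;
  set k := core_rel ks in ksP cycle_ks hs_conn.
have k_sym : symmetric k by move=> u v; rewrite /k /core_rel /= orbC.
have k_sub : subrel k e.
  by move=> u v /orP[] /ksP /andP[/=]; rewrite // e_sym.
pose H := [set v | connect k root v].
have k_H u v : k u v -> u \in H.
  rewrite inE => uv; case/orP: (uv) => /ksP /andP[_ //] /= root_v.
  by apply: connect_trans root_v _; rewrite connect1 // k_sym.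
have k_conn : {in H, forall h, connect k root h} by move=> h; rewrite inE.
have root_H : root \in H by rewrite inE connect0.
have [x [xH xk]] := core_retraction e_sym e_irr e_conn c_only k_sym k_sub
  cycle_ks root_H k_H k_conn g.
exists x => f; apply: le_trans (dirichlet_le (ks := ks) _) _ => [u v uv|].
  by rewrite /= => fuv; apply: contraNT fuv => /(xk u v uv) ->.
rewrite lerMn2r /= addrCA -lerBlDl.
rewrite [X in X - _ <= _](_ : _ = \sum_(z <- ks) `|f (g z.1) - f (g z.2)| ^+ 2).
  rewrite subrr subr_ge0.
  rewrite (eq_big_seq (fun h => `|f (x h)| ^+ 2)) => [|h /hs_conn h_in];
    last by rewrite xH // inE.
  rewrite big_uniq //= [leRHS](bigID (mem hs)) /= lerDl.
  by apply: sumr_ge0 => i _; apply: exprn_ge0.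
apply: eq_big_seq => -[u v] /= uv_in;
  have uvk : k u v by rewrite /k /core_rel /= uv_in.
by rewrite !xH ?(k_H v u) ?(k_H u v) // k_sym.
Qed.

End Bounds.

Lemma core_rel_sym (T : finType) (ks : seq (T * T)) : symmetric (core_rel ks).
Proof. by move=> u v; rewrite /core_rel /= orbC. Qed.

Lemma core_rel_steps (T : finType) (ks : seq (T * T)) (u : T) xs :
  {subset steps u xs <= ks} -> {in u :: xs, forall v, connect (core_rel ks) u
    v}.
Proof.
by move=> sub; apply: connect_steps => -[x y] /sub ks_in;
  rewrite /core_rel /= ks_in.
Qed.

(** * The two kinds of core inside the graph *)

Section Models.

Variables (C : numClosedFieldType) (T : finType) (e : rel T) (c : seq T).
Hypotheses (e_sym : symmetric e) (e_irr : irreflexive e).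
Hypotheses (e_conn : connected_graph e) (c_only : only_cycle e c).

Lemma cycle_edges_core (ks : seq (T * T)) x p u v :
    graph_cycle e (x :: p) -> {subset steps x (rcons p x) <= ks} ->
  [set u; v] \in cycle_edges c -> core_rel ks u v.
Proof.
move=> cyc sub; rewrite -(cycle_edges_only c_only cyc).
case/imsetP => y y_in eq_uv; rewrite (set2_rel (core_rel_sym ks) eq_uv).
by rewrite /core_rel /= sub // steps_next.
Qed.

Lemma two_tail_cycle_model p q S Q A B :
    graph_cycle e (p :: S ++ q :: Q) -> path e p A -> path e q B ->
    uniq (p :: S ++ q :: Q ++ A ++ B) ->
  two_tail_cycle C e (size A) (size B) (size S).+1 (size Q).+1.
Proof.
move=> cyc pA qB hs_uniq V al be A' B' S' Q' sA sB [sS] [sQ].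
have [g] : exists g : T -> V,
    map g (p :: S ++ q :: Q ++ A ++ B) = al :: S' ++ be :: Q' ++ A' ++ B'.
  by apply: labelling => //=; rewrite !size_cat /= !size_cat sA sB sS sQ.
move/eqP; rewrite /= eqseq_cons map_cat eqseq_cat ?size_map //= eqseq_cons.
rewrite !map_cat !eqseq_cat ?size_map //.
case/andP=> /eqP gp /and5P[/eqP gS /eqP gq /eqP gQ /eqP gA /eqP gB].
pose ks := steps p (rcons S q) ++ steps q (rcons Q p) ++ steps p A ++ steps q B.
have sub1 : {subset steps p (rcons S q) <= ks}.
  by move=> z; rewrite /ks !mem_cat => ->.
have sub2 : {subset steps q (rcons Q p) <= ks}.
  by move=> z; rewrite /ks !mem_cat => ->; rewrite !orbT.
have sub3 : {subset steps p A <= ks}.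
  by move=> z; rewrite /ks !mem_cat => ->; rewrite !orbT.
have sub4 : {subset steps q B <= ks}.
  by move=> z; rewrite /ks !mem_cat => ->; rewrite !orbT.
have conn1 := core_rel_steps sub1; have conn3 := core_rel_steps sub3.
have pq : connect (core_rel ks) p q.
  by apply: conn1; rewrite in_cons mem_rcons mem_head orbT.
have conn2 : {in q :: rcons Q p, forall v, connect (core_rel ks) p v}.
  by move=> v /(core_rel_steps sub2); apply: connect_trans.
have conn4 : {in q :: B, forall v, connect (core_rel ks) p v}.
  by move=> v /(core_rel_steps sub4); apply: connect_trans.
have [pS qQ] : path e p (rcons S q) /\ path e q (rcons Q p).
  case/andP: cyc => /andP[/= + _] _.
  by rewrite rcons_cat rcons_cons -cat_rcons cat_path last_rcons => /andP.
have [||||x xP] := core_extension C e_sym e_irr e_conn c_only (ks := ks)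
    (hs := p :: S ++ q :: Q ++ A ++ B) (root := p) _ _ _ _ g => //.
- move=> z; rewrite /ks !mem_cat => /or4P[] z_in;
  rewrite (steps_path _ z_in) //=;
    case/mem_steps/andP: z_in => /mem_belast z1 _; auto.
- move=> u v uv; apply: cycle_edges_core cyc _ => z.
  by rewrite rcons_cat rcons_cons -cat_rcons steps_cat last_rcons mem_cat =>
    /orP[/sub1|/sub2].
- move=> h; rewrite in_cons -cat_rcons !mem_cat => /or4P[/eqP->|h_in|h_in|].
  + exact: connect0.
  + by apply: conn1; rewrite in_cons h_in orbT.
  + by apply: conn2; rewrite in_cons mem_rcons in_cons h_in !orbT.
  by case/orP => h_in; [apply: conn3|apply: conn4]; rewrite in_cons h_in orbT.
exists x => f; apply: le_trans (xP f) _; rewrite lerMn2r /= lerD2l.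
rewrite le_eqVlt; apply/orP; left; apply/eqP.
rewrite -gp -gq -gA -gB -gS -gQ -!map_rcons -!map_comp.
rewrite -!/((f \o g) _) !line_form_steps.
rewrite /ks -!cats1 !(big_cat, big_cons, big_nil) /=; ring.
Qed.

Lemma path_and_cycle_model x0 P c0 Q R :
    path e x0 P -> uniq (x0 :: P) -> graph_cycle e (c0 :: Q) -> path e c0 R ->
    ~~ has (mem Q) (x0 :: P) -> ~~ has (mem Q) (c0 :: R) ->
    last c0 R \in x0 :: P ->
    {in c0 :: R, forall z, z \in x0 :: P -> z = last c0 R} ->
  path_and_cycle C e (size P) (index (last c0 R) (x0 :: P)) (size Q).+1.
Proof.
set w := last c0 R => pP P_uniq cyc pR QP QR wP R_w V xi P' Q' sP [sQ] al.
have hs_uniq : uniq ((x0 :: P) ++ Q).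
  rewrite cat_uniq P_uniq has_sym QP /=.
  by case/andP: cyc => /andP[_ /=/andP[]].
have [g] : exists g : T -> V, map g ((x0 :: P) ++ Q) = (xi :: P') ++ Q'.
  by apply: labelling => //=; rewrite !size_cat sP sQ.
move/eqP; rewrite map_cat eqseq_cat ?size_map /= ?sP // => /andP[/eqP gP /eqP
  gQ].
have gw : g w = al.
  rewrite /al -gP -/(map g (x0 :: P)) (nth_map x0) ?index_mem //.
  by rewrite nth_index.
(* The whole link, including its end on the cycle, carries the value of the path vertex it reaches,
   so its edges cost nothing. *)
pose h v := if v \in c0 :: R then al else g v.
have hP : map h (x0 :: P) = xi :: P'.
  rewrite -gP -[RHS]/(map g (x0 :: P)); apply/eq_in_map => v vP; rewrite /h;
    case: ifP => // vR.
  by rewrite (R_w v vR vP) gw.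
have hQ : map h Q = Q'.
  rewrite -gQ; apply/eq_in_map => v vQ; rewrite /h; case: ifP => // vR.
  by case/hasP: QR; exists v.
have hR v : v \in c0 :: R -> h v = al by rewrite /h => ->.
pose ks := steps x0 P ++ steps c0 (rcons Q c0) ++ steps c0 R.
have sub1 : {subset steps x0 P <= ks} by move=> z; rewrite /ks !mem_cat => ->.
have sub2 : {subset steps c0 (rcons Q c0) <= ks}.
  by move=> z; rewrite /ks !mem_cat => ->; rewrite !orbT.
have sub3 : {subset steps c0 R <= ks}.
  by move=> z; rewrite /ks !mem_cat => ->; rewrite !orbT.
have conn2 := core_rel_steps sub2; have conn3 := core_rel_steps sub3.
have conn1 : {in x0 :: P, forall v, connect (core_rel ks) c0 v}.
  move=> v /(core_rel_steps sub1); apply: connect_trans.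
  apply: connect_trans (conn3 w (mem_last _ _)) _.
  by rewrite (sym_connect_sym (@core_rel_sym _ ks)) (core_rel_steps sub1).
have [||||x xP] := core_extension C e_sym e_irr e_conn c_only (ks := ks)
    (hs := (x0 :: P) ++ Q) (root := c0) _ _ _ _ h => //.
- move=> z; rewrite /ks !mem_cat => /or3P[] z_in;
  rewrite (steps_path _ z_in) //=;
    try (by case/mem_steps/andP: z_in => /mem_belast z1 _; auto).
  by case/andP: cyc => /andP[].
- by move=> u v uv; apply: cycle_edges_core cyc _ => z /sub2.
- move=> v; rewrite mem_cat => /orP[/conn1//|v_in].
  by apply: conn2; rewrite in_cons mem_rcons in_cons v_in !orbT.
exists x => f; apply: le_trans (xP f) _; rewrite lerMn2r /= lerD2l.
rewrite le_eqVlt; apply/orP; left; apply/eqP.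
have hc0 : h c0 = al by rewrite hR ?mem_head.
case: hP => hx0 hP.
rewrite -hc0 -hx0 -hP -hQ -!map_rcons -!map_comp -!/((f \o h) _)
  !line_form_steps.
rewrite /ks -!cats1 !(big_cat, big_cons, big_nil) /=.
rewrite [X in _ + (_ + X)]big1_seq => [|z /andP[_ /mem_steps/andP[/mem_belast
  z1 z2]]]; first by ring.
by rewrite !hR ?subrr ?normr0 ?expr0n // in_cons z2 orbT.
Qed.

End Models.

(** * Diametral paths and the cycle *)

Local Open Scope nat_scope.

Section Splitting.

Variables (T : eqType).
Implicit Types (a : pred T) (s : seq T).

Lemma has_split_first a s : has a s ->
  exists s1 x s2, [/\ s = s1 ++ x :: s2, a x & ~~ has a s1].
Proof.
elim: s => //= y s IH; have [ay _|ayN /= /IH[s1 [x [s2 [-> ax s1N]]]]] := boolP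
  (a y).
  by exists [::], y, s.
by exists (y :: s1), x, s2; rewrite /= negb_or ayN.
Qed.

Lemma has_split_last a s : has a s ->
  exists s1 x s2, [/\ s = s1 ++ x :: s2, a x & ~~ has a s2].
Proof.
rewrite -has_rev => /has_split_first[s1 [x [s2 [def_s ax s1N]]]].
exists (rev s2), x, (rev s1); rewrite has_rev; split=> //.
by rewrite -[s]revK def_s rev_cat rev_cons cat_rcons.
Qed.

Lemma steps_split u xs (z : T * T) : z \in steps u xs ->
  exists xs1 xs2, xs = xs1 ++ z.2 :: xs2 /\ last u xs1 = z.1.
Proof.
elim: xs u => // x xs IH u; rewrite steps_cons in_cons => /predU1P[->|/IH].
  by exists [::], xs.
by case=> xs1 [xs2 [-> lst]]; exists (x :: xs1), xs2.
Qed.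

End Splitting.

Section Geodesic.

Variables (T : finType) (e : rel T).

Definition geodesic x p : Prop := path e x p /\
  forall p', path e x p' -> last x p' = last x p -> size p <= size p'.

Lemma geodesic_uniq x p : geodesic x p -> uniq (x :: p).
Proof.
case; have [y last_p] : {y | last x p = y} by exists (last x p).
rewrite last_p => xp min_p.
case/shortenP: xp (last_p) => p' xp' uniq_p' sub_p' last_p'.
apply: leq_size_uniq uniq_p' _ _; last by rewrite /= ltnS min_p.
by move=> z; rewrite !in_cons => /predU1P[->|/sub_p'->]; rewrite ?eqxx ?orbT.
Qed.

Lemma walkP x y n :
  reflect (exists p, [/\ size p = n, path e x p & last x p = y]) (walk e x y n).
Proof.
apply: (iffP existsP) => [[p /andP[xp /eqP last_p]]|[p [sp xp last_p]]].
  by exists p; rewrite size_tuple.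
move/eqP: sp => sp; exists (Tuple sp).
by rewrite /= xp last_p eqxx.
Qed.

Lemma gdist_geodesic x y : connect e x y ->
  exists p, [/\ geodesic x p, last x p = y & size p = gdist e x y].
Proof.
move=> /connectP[p0 path0 ->]; have [p xp uniq_p _] := shortenP path0.
have lt_p : size p < #|T|.
  by rewrite -[(size p).+1]/(size (x :: p)) -(card_uniqP uniq_p) max_card.
have hasw : has (walk e x (last x p)) (iota 0 #|T|).
  apply/hasP; exists (size p); rewrite ?mem_iota //.
  by apply/walkP; exists p.
have lt_d : gdist e x (last x p) < #|T|.
  by move: hasw; rewrite has_find size_iota.
have /walkP[q [sq xq last_q]] : walk e x (last x p) (gdist e x (last x p)).
  by have := nth_find 0 hasw; rewrite nth_iota.
exists q; split=> //; split=> // q' xq' last_q'; rewrite leqNgt sq.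
apply/negP => lt_q'; have := before_find 0 lt_q'.
rewrite nth_iota; last exact: ltn_trans lt_d.
by case/walkP; exists q'; rewrite last_q' last_q.
Qed.

Lemma diameter_geodesic : connected_graph e -> 0 < #|T| ->
  exists x p, geodesic x p /\ size p = diameter e.
Proof.
move=> e_conn T_gt0; rewrite /diameter.
have [x ->] := bigop.eq_bigmax (fun x => \max_y gdist e x y) T_gt0.
have [y ->] := bigop.eq_bigmax (gdist e x) T_gt0.
by have [p [geo_p _ sp]] := gdist_geodesic (e_conn x y); exists x, p.
Qed.

Hypothesis e_sym : symmetric e.

Lemma sym_rev_path x p : path e (last x p) (rev (belast x p)) = path e x p.
Proof. by rewrite rev_path; apply: eq_path => u v; rewrite e_sym. Qed.

Lemma graph_cycle_rot n c : graph_cycle e c -> graph_cycle e (rot n c).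
Proof.
by rewrite /graph_cycle /ucycleb rot_cycle rot_uniq size_rot.
Qed.

Lemma graph_cycle_rev x p : graph_cycle e (x :: p) -> graph_cycle e (x :: rev
  p).
Proof.
rewrite /graph_cycle /ucycleb /= rev_uniq mem_rev size_rev.
have := sym_rev_path x (rcons p x); rewrite last_rcons belast_rcons rev_cons.
by move=> ->.
Qed.

End Geodesic.

(** * Paths between vertices of the cycle *)

Section Arcs.

Variables (T : finType) (e : rel T) (c : seq T).
Hypotheses (e_sym : symmetric e) (e_irr : irreflexive e).
Hypotheses (e_conn : connected_graph e) (c_only : only_cycle e c).

(** If an edge of the path were not on the cycle, its ends would stay connected without it, along
    the two remaining pieces of the path and around the cycle, contradicting [edge_on_cycle]. *)
Lemma path_between_on_cycle p xs (z : T * T) :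
    p \in c -> last p xs \in c -> path e p xs -> uniq (p :: xs) ->
  z \in steps p xs -> [set z.1; z.2] \in cycle_edges c.
Proof.
case: z => u v pc qc pxs xs_uniq /= /steps_split[xs1 [xs2 [def_xs last_xs1]]].
rewrite /= in last_xs1 def_xs; subst xs u.
move: pxs xs_uniq qc; rewrite cat_path last_cat [last _ (_ :: _)]/= -cat_cons
  cat_uniq.
set u := last p xs1 => /and3P[p_xs1 uv v_xs2] /and3P[_ disj _] qc.
apply/negPn/negP => uv_notin; case/negP: (uv_notin).
apply: (edge_on_cycle e_sym e_irr c_only uv); set r := (X in connect X).
have r_sym : connect_sym r.
  by apply: sym_connect_sym => x y; rewrite /r /= e_sym setUC.
have pu : connect r p u.
  apply/connectP; exists xs1 => //.
  apply: (@sub_in_path _ (mem (p :: xs1))) p_xs1; last exact/allP.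
  move=> x y x_in y_in xy; rewrite /r /= xy [X in _ != X]setUC.
  by apply: set2_neq; apply: contraNneq disj => xv; apply/hasP;
    exists v; rewrite ?mem_head //= -xv.
have vq : connect r v (last v xs2).
  apply/connectP; exists xs2 => //.
  apply: (@sub_in_path _ (mem (v :: xs2))) v_xs2; last exact/allP.
  move=> x y x_in y_in xy; rewrite /r /= xy.
  have u_in : u \in p :: xs1 by apply: mem_last.
  by apply: set2_neq; apply: contraNneq disj => xu; apply/hasP; exists u;
    rewrite //= -xu.
rewrite r_sym; apply: connect_trans vq _; rewrite r_sym.
rewrite r_sym in pu; apply: connect_trans pu _.
have /and3P[c_cyc c_uniq _] : [&& cycle e c, uniq c & 2 < size c].
  by rewrite andbA; exact: c_only.1.
have : fconnect (next c) p (last v xs2).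
  by rewrite (fconnect_cycle (cycle_next c_uniq) pc).
apply: connect_sub => x _ /eqP <-.
have [xc|xNc] := boolP (x \in c); last by rewrite next_nth (negPf xNc) connect0.
apply: connect1; rewrite /r /= next_cycle //.
by apply: contraNneq uv_notin => <-; apply/imsetP; exists x.
Qed.

(** A cycle edge at [u] leads to one of its two neighbours on the cycle; avoiding visited vertices
    forces the forward one. *)
Lemma cycle_path_follows h l u r xs :
    graph_cycle e (h :: l ++ u :: r) -> uniq xs ->
    ~~ has (mem (h :: rcons l u)) xs ->
    (forall z, z \in steps u xs -> [set z.1; z.2] \in cycle_edges c) ->
  exists r', r = xs ++ r'.
Proof.
elim: xs l u r => [|v xs IH] l u r cyc; first by exists r.
case/andP => v_notin xs_uniq /=; rewrite negb_or => /andP[v_new xs_new] steps_c.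
have uv_c := steps_c (u, v) (mem_head _ _).
have cyc_uniq : uniq (h :: l ++ u :: r) by case/andP: cyc => /andP[].
have u_r : u \notin r /\ u != h.
  move: cyc_uniq => /= /andP[+]; rewrite mem_cat cat_uniq in_cons => h_notin.
  case/and3P => _ _ /andP[-> _]; split=> //.
  by apply: contraNneq h_notin => ->; rewrite eqxx orbT.
have /orP := cycle_edges_core c_only cyc (fun z z_in => z_in) uv_c.
have -> : steps h (rcons (l ++ u :: r) h) =
          steps h (rcons l u) ++ steps u (rcons r h).
  by rewrite rcons_cat rcons_cons -cat_rcons steps_cat last_rcons.
rewrite !mem_cat => -[/orP[]|/orP[]] /=.
- move/mem_steps/andP => /= [_ v_in].
  by move: v_new; rewrite in_cons v_in orbT.
- case: r cyc cyc_uniq u_r => [|v' r] cyc cyc_uniq [u_r _].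
    by rewrite /= inE => /eqP[vh]; move: v_new; rewrite vh mem_head.
  rewrite rcons_cons steps_cons in_cons => /predU1P[[vv']|]; last first.
    by move/mem_steps/andP => /= []; rewrite belast_rcons (negPf u_r).
  subst v'; have [|||r' ->] := IH (rcons l u) v r _ xs_uniq.
  + by rewrite cat_rcons.
  + apply/hasPn => x x_in; suff : x \notin rcons (h :: rcons l u) v by [].
    have x_new : x \notin h :: rcons l u := hasPn xs_new x x_in.
    rewrite mem_rcons in_cons negb_or x_new andbT.
    by apply: contraNneq v_notin => <-.
  + by move=> z z_in; apply: steps_c; rewrite in_cons z_in orbT.
  by exists r'.
- move/mem_steps/andP => /= [v_in _]; move: v_new.
  by rewrite belast_rcons in v_in;
    rewrite -rcons_cons mem_rcons in_cons v_in orbT.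
- move/mem_steps/andP => /= [_]; rewrite mem_rcons in_cons.
  by rewrite (negPf u_r.1) (negPf u_r.2).
Qed.

(** The first step of the path fixes the orientation: the cycle is rotated to [p] and reversed if
    that step runs backwards. *)
Lemma cycle_through_path p xs :
    p \in c -> last p xs \in c -> path e p xs -> uniq (p :: xs) -> xs != [::] ->
  exists Q, [/\ graph_cycle e (p :: xs ++ Q), size (p :: xs ++ Q) = size c &
               p :: xs ++ Q =i c].
Proof.
move=> pc qc pxs xs_uniq xs0.
have steps_c := path_between_on_cycle pc qc pxs xs_uniq.
have [i c1 def_c] := rot_to pc.
have cyc1 : graph_cycle e (p :: c1) by rewrite -def_c graph_cycle_rot //;
  exact: c_only.1.
have size1 : size (p :: c1) = size c by rewrite -def_c size_rot.
have mem1 : p :: c1 =i c by move=> x; rewrite -def_c mem_rot.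
suff [c2 [cyc2 size2 mem2 [Q def_c2]]] : exists c2, [/\ graph_cycle e (p :: c2),
    size (p :: c2) = size c, p :: c2 =i c & exists Q, c2 = xs ++ Q].
  by exists Q; rewrite -def_c2.
case: xs xs0 pxs xs_uniq steps_c {qc} => // v xs _ pxs xs_uniq steps_c.
have follow c2 : graph_cycle e (p :: v :: c2) -> exists Q, v :: c2 = v :: xs ++
  Q.
  move=> cyc2; have [|||Q ->] := @cycle_path_follows p [::] v c2 xs cyc2.
  - by case/and3P: xs_uniq.
  - move: xs_uniq => /= /and3P[];
    rewrite in_cons negb_or => /andP[_ p_xs] v_xs _.
    by apply/hasPn => x x_in; rewrite !inE negb_or; apply/andP; split;
      [apply: contraNneq p_xs|apply: contraNneq v_xs] => <-.
  - by move=> z z_in; apply: steps_c; rewrite steps_cons in_cons z_in orbT.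
  by exists Q.
have pv_c := steps_c (p, v) (mem_head _ _).
have p_c1 : p \notin c1 by case/andP: cyc1 => /andP[_ /andP[]].
have /orP := cycle_edges_core c_only cyc1 (fun z z_in => z_in) pv_c.
case.
  case: c1 cyc1 size1 mem1 p_c1 {def_c} => [|y c2] cyc1 size1 mem1 p_c1.
    by case/andP: cyc1.
  rewrite rcons_cons steps_cons in_cons => /predU1P[[vy]|]; last first.
    by move/mem_steps/andP => /= []; rewrite belast_rcons (negPf p_c1).
  by subst y; exists (v :: c2); split=> //; apply: follow.
case/lastP: c1 cyc1 size1 mem1 p_c1 {def_c} => [|c2 y] cyc1 size1 mem1 p_c1.
  by case/andP: cyc1.
rewrite -cats1 steps_cat last_rcons mem_cat => /orP[|].
  by move/mem_steps/andP => /= [_]; rewrite (negPf p_c1).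
rewrite /= inE => /eqP[vy]; subst y.
have cyc2 : graph_cycle e (p :: v :: rev c2).
  by have := graph_cycle_rev e_sym cyc1; rewrite rev_rcons.
exists (v :: rev c2); split=> //; last exact: follow.
  by rewrite -size1 /= size_rev size_rcons.
by move=> x; rewrite -mem1 !in_cons mem_rev mem_rcons in_cons.
Qed.

End Arcs.

(** * The core formed by a diametral path and the cycle *)

Section Configurations.

Variables (C : numClosedFieldType) (T : finType) (e : rel T) (c : seq T).
Hypotheses (e_sym : symmetric e) (e_irr : irreflexive e).
Hypotheses (e_conn : connected_graph e) (c_only : only_cycle e c).

Lemma path_to_first (b : pred T) u p : path e u p -> b (last u p) ->
  exists q, [/\ path e u q, b (last u q) & ~~ has b (belast u q)].
Proof.
elim: p u => [|w p IH] u /=; first by exists [::].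
case/andP => uw /IH + /[dup] b_last => /[apply] -[q [wq bq qN]].
have [bu|buN] := boolP (b u); first by exists [::].
by exists (w :: q); rewrite /= uw wq negb_or buN.
Qed.

Lemma path_from_last (a : pred T) u p : path e u p -> has a (u :: p) ->
  exists v q, [/\ path e v q, a v, last v q = last u p, ~~ has a q
                & {subset belast v q <= belast u p}].
Proof.
elim: p u => [|w p IH] u.
  by move=> _; rewrite /= orbF => au; exists u, [::].
case/andP => uw wp; have [ap _|apN] := boolP (has a (w :: p)).
  have [v [q [vq av last_q qN sub]]] := IH w wp ap.
  by exists v, q; split=> // z /sub /=; rewrite in_cons orbC => ->.
case/orP => [au|ap]; last by case/negP: apN.
by exists u, (w :: p); split=> //; apply/andP.
Qed.

(** A connecting path is cut at its first vertex in [b], then its part before the last vertex in [a]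
    is dropped. *)
Lemma shortest_link (a b : pred T) u v : a u -> b v ->
  exists w q, [/\ path e w q, a w, b (last w q), ~~ has a q
                & ~~ has b (belast w q)].
Proof.
move=> au bv; have /connectP[p0 up0 def_v] := e_conn u v.
rewrite def_v in bv; have [p [up bp pN]] := path_to_first up0 bv.
have [|w [q [wq aw last_q qN sub]]] := path_from_last (a := a) up.
  by rewrite /= au.
exists w, q; rewrite last_q; split=> //.
by apply: contra pN => /hasP[z /sub z_in bz]; apply/hasP; exists z.
Qed.

Lemma configuration x0 P : geodesic e x0 P ->
  (exists j, path_and_cycle C e (size P) j (size c)) \/
  exists a b s m, [/\ two_tail_cycle C e a b s m, size P = (a + s + b)%N,
                      size c = (s + m)%N & (0 < s <= m)%N].
Proof.
move=> geoP; have [pP minP] := geoP; have P_uniq := geodesic_uniq geoP.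
have c_cyc : graph_cycle e c := c_only.1.
have c_uniq : uniq c by case/andP: c_cyc => /andP[].
have [P_c|P_c] := boolP (has (mem c) (x0 :: P)); last first.
  left; have [u uc] : exists u, u \in c.
    by case: (c) c_cyc => [|u c'] //; exists u; rewrite mem_head.
  have [c0 [R [cR c0c RP RNc RNP]]] :=
    shortest_link (a := mem c) (b := mem (x0 :: P)) uc (mem_head x0 P).
  have [i Q def_c] := rot_to c0c.
  have cyc : graph_cycle e (c0 :: Q) by rewrite -def_c graph_cycle_rot.
  have mem_c : c0 :: Q =i c by move=> z; rewrite -def_c mem_rot.
  exists (index (last c0 R) (x0 :: P)).
  rewrite -(size_rot i c) def_c; apply: (path_and_cycle_model C e_sym e_irr
    e_conn c_only pP P_uniq cyc cR) => //.
  - apply: contra P_c => /hasP[z zP zQ]; apply/hasP; exists z => //.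
    by rewrite /= -mem_c in_cons [z \in Q]zQ orbT.
  - rewrite /= negb_or; apply/andP; split;
    first by case/andP: cyc => /andP[_ /andP[]].
    apply: contra RNc => /hasP[z zP zQ]; apply/hasP; exists z => //.
    by rewrite /= -mem_c in_cons [z \in Q]zQ orbT.
  - move=> z; rewrite lastI mem_rcons in_cons => /predU1P[//|zR zP].
    by case/hasP: RNP; exists z.
(* [p] is the first path vertex on the cycle; the path before it, read backwards, is one tail. *)
have [A' [p [R [def_P pc A'c]]]] := has_split_first P_c.
have [P1 [def_P1 def_p def_A']] : exists P1,
    [/\ P = P1 ++ R, last x0 P1 = p & belast x0 P1 = A'].
  case: A' def_P {A'c} => [|y A'] [-> ->]; first by exists [::].
  exists (rcons A' p); rewrite cat_rcons last_rcons belast_rcons; split=> //.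
subst P p A'; set p := last x0 P1 in pc *.
have size_P1 : size P1 = size (rev (belast x0 P1)) by rewrite size_rev
  size_belast.
have pA : path e p (rev (belast x0 P1)).
  by rewrite sym_rev_path //; move: pP; rewrite cat_path => /andP[].
(* Either [p] is the only contact and the link is trivial, or [q] is the last contact and [B] the
   other tail. *)
have [/has_split_last[S [q [B [def_R qc Bc]]]]|R_c] := boolP (has (mem c) R);
  last first.
  left; have [i Q def_c] := rot_to pc.
  have cyc : graph_cycle e (p :: Q) by rewrite -def_c graph_cycle_rot.
  have mem_c : p :: Q =i c by move=> z; rewrite -def_c mem_rot.
  have pQ : p \notin Q by case/andP: cyc => /andP[_ /andP[]].
  exists (index p (x0 :: P1 ++ R)).
  rewrite -(size_rot i c) def_c; apply: (path_and_cycle_model C e_sym e_irr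
    e_conn c_only pP P_uniq cyc (R := [::])) => //=.
  - rewrite -/(has _ (x0 :: P1 ++ R)) def_P.
    apply/hasPn => z; rewrite mem_cat in_cons => zP; apply: contraL zP => zQ.
    have zc : z \in c by rewrite -mem_c in_cons [z \in Q]zQ orbT.
    rewrite !negb_or; apply/and3P; split.
    + by apply: contra A'c => zA; apply/hasP; exists z.
    + by apply: contraTneq zQ => ->.
    + by apply: contra R_c => zR; apply/hasP; exists z.
  - by rewrite orbF.
  - by rewrite -/(p \in x0 :: P1 ++ R) def_P mem_cat mem_head orbT.
  - by move=> z; rewrite inE => /eqP.
right; subst R; rewrite -cat_rcons in pP minP P_uniq *.
have PS_uniq : uniq (p :: rcons S q ++ B).
  have : uniq (belast x0 P1 ++ p :: rcons S q ++ B) by rewrite cat_rcons -def_P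
    -cat_rcons.
  by rewrite cat_uniq => /and3P[].
have [p_S q_B] : path e p (rcons S q) /\ path e q B.
  by move: pP; rewrite !cat_path last_rcons => /and3P[].
have [|||Q [cyc size_cyc mem_cyc]] := cycle_through_path e_sym e_irr c_only pc
  (xs := rcons S q) _ p_S.
- by rewrite last_rcons.
- by move: PS_uniq; rewrite -cat_cons cat_uniq => /andP[].
- by case: (S).
rewrite cat_rcons in cyc size_cyc mem_cyc.
exists (size P1), (size B), (size S).+1, (size Q).+1; split.
- rewrite size_P1; apply: (two_tail_cycle_model C e_sym e_irr e_conn c_only cyc
  pA q_B).
  have -> : p :: S ++ q :: Q ++ rev (belast x0 P1) ++ B =
            (p :: S ++ q :: Q) ++ rev (belast x0 P1) ++ B.
    by rewrite /= -catA.
  have Pu : uniq (belast x0 P1 ++ p :: rcons S q ++ B).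
    by rewrite cat_rcons -def_P -cat_rcons.
  rewrite cat_uniq; apply/and3P; split; first by case/andP: cyc => /andP[].
    apply/hasPn => z; rewrite mem_cat mem_rev => z_in.
    suff : z \notin p :: S ++ q :: Q by [].
    rewrite mem_cyc; apply: contraL z_in => zc; rewrite negb_or; apply/andP;
      split.
      by apply: contra A'c => zA; apply/hasP; exists z.
    by apply: contra Bc => zB; apply/hasP; exists z.
  move: Pu; rewrite -cat_cons !cat_uniq rev_uniq => /and3P[-> disj /and3P[_ _
    ->]].
  rewrite andbT /=; apply: contra disj => /hasP[z zB zA]; apply/hasP; exists z.
    by rewrite mem_cat zB orbT.
  by move: zA; rewrite /= mem_rev.
- by rewrite !size_cat size_rcons addnA.
- by rewrite -size_cyc /= size_cat addSn.
rewrite ltn0Sn ltnS.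
have qQ : path e q (rcons Q p).
  case/andP: cyc => /andP[/= + _] _.
  by rewrite rcons_cat rcons_cons cat_path /= => /and3P[].
(* Exchanging the arc inside the path for the other one yields a competing path with the same ends,
   so s <= m. *)
have := minP (P1 ++ rcons (rev Q) q ++ B).
rewrite !cat_path !last_cat !last_rcons q_B andbT => min'.
have : size (P1 ++ rcons S q ++ B) <= size (P1 ++ rcons (rev Q) q ++ B).
  apply: min' => //; move: pP; rewrite cat_path => /andP[-> _] /=.
  have := sym_rev_path e_sym q (rcons Q p).
  by rewrite last_rcons belast_rcons rev_cons qQ.
by rewrite !size_cat !size_rcons size_rev leq_add2l leq_add2r.
Qed.

End Configurations.

(** * The bound *)

Local Close Scope nat_scope.

Lemma ceil_div_le (n k m : nat) : (0 < k)%N -> (n <= m * k)%N ->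
  Num.ceil (n%:R / k%:R : rat) <= m%:Z.
Proof.
move=> k_gt0 le_n; rewrite ceil_le_int ler_pdivrMr ?ltr0n //.
by rewrite -[m%:~R]/(m%:R) -natrM ler_nat.
Qed.

(** When 3 divides neither tail, the generic count falls short only if both tails are 2 modulo 3 and
    3 divides [s], and then by at most one, which [two_tail_cycle_two_two] recovers. *)
Lemma two_tail_cycle_bound (C : numClosedFieldType) (T : finType) (e : rel T)
    a b s m : symmetric e -> (0 < s <= m)%N -> two_tail_cycle C e a b s m ->
  ((a + s + b + 2) %/ 3 + (s + m + 5) %/ 6 <= (m01 C e).+1)%N.
Proof.
move=> e_sym /andP[s_gt0 le_sm] mod_ab; have m_gt0 := leq_trans s_gt0 le_sm.
have mod_ba := two_tail_cycleC mod_ab.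
have [a3|a3] := boolP (3 %| a)%N; have [b3|b3] := boolP (3 %| b)%N.
- have := two_tail_cycle_dvd_dvd s_gt0 m_gt0 a3 b3 mod_ab.
  by move/(test_space_m01 e_sym); clear -a3 b3 le_sm s_gt0; lia.
- have b3' : (b %% 3 != 0)%N by [].
  have := two_tail_cycle_ndvd_dvd m_gt0 s_gt0 b3' a3 mod_ba.
  by move/(test_space_m01 e_sym); clear -a3 b3 le_sm s_gt0; lia.
- have a3' : (a %% 3 != 0)%N by [].
  have := two_tail_cycle_ndvd_dvd s_gt0 m_gt0 a3' b3 mod_ab.
  by move/(test_space_m01 e_sym); clear -a3 b3 le_sm s_gt0; lia.
have a3' : (a %% 3 != 0)%N by [].
have b3' : (b %% 3 != 0)%N by [].
have [/and3P[/eqP a2 /eqP b2 s3]|] := boolP [&& a %% 3 == 2, b %% 3 == 2 & 3 %|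
  s]%N.
  have := two_tail_cycle_two_two s_gt0 m_gt0 a2 b2 s3 mod_ab.
  by move/(test_space_m01 e_sym); clear -a2 b2 s3 le_sm s_gt0; lia.
have := two_tail_cycle_ndvd_ndvd s_gt0 m_gt0 a3' b3' mod_ab.
by move/(test_space_m01 e_sym); clear -a3' b3' le_sm s_gt0; lia.
Qed.

Theorem theorem4p1 (C : numClosedFieldType) (T : finType) (e : rel T)
    (e_sym : symmetric e) (e_irr : irreflexive e)
    (G_unicyclic : unicyclic e) (r : nat) (G_girth : unicyclic_girth e r) :
  Num.ceil ((diameter e)%:R / 3 : rat) + Num.ceil (r%:R / 6 : rat) - 1
    <= (m01 C e)%:Z.
Proof.
have [e_conn _] := G_unicyclic; have [c c_only size_c] := G_girth.
suff bound : ((diameter e + 2) %/ 3 + (r + 5) %/ 6 <= (m01 C e).+1)%N.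
  have d_le : Num.ceil ((diameter e)%:R / 3 : rat) <= ((diameter e + 2) %/
    3)%N%:Z.
    by apply: ceil_div_le => //; lia.
  have r_le : Num.ceil (r%:R / 6 : rat) <= ((r + 5) %/ 6)%N%:Z.
    by apply: ceil_div_le => //; lia.
  by rewrite lerBlDr; apply: le_trans (lerD d_le r_le) _; lia.
have r_ge3 : (3 <= r)%N by rewrite -size_c; case/andP: (c_only.1).
have T_gt0 : (0 < #|T|)%N.
  by rewrite -size_c in r_ge3; case: (c) r_ge3 => // x *; apply/card_gt0P;
    exists x.
have [x0 [P [geoP sizeP]]] := diameter_geodesic e_conn T_gt0.
have [[j]|[a [b [s [m [mod_ab size_P size_sm le_sm]]]]]] :=
  configuration C e_sym e_irr e_conn c_only geoP.
  rewrite sizeP size_c => /path_and_cycle_test_space.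
  move=> /(_ (leq_trans (isT : (0 < 3)%N) r_ge3)) /(test_space_m01 e_sym).
  by clear -r_ge3; lia.
have := two_tail_cycle_bound e_sym le_sm mod_ab.
by rewrite -sizeP -size_c size_P size_sm.
Qed.
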